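(* Let $(X,M_1,*_1)$ and $(Y,M_2,*_2)$ be fuzzy metric spaces such that, for $i=1,2$, $a*_i b\neq0$ whenever $a\neq0$ and $b\neq0$ ($a,b\in[0,1]$). Let $f:X\to Y$ be a coarse equivalence. Then $\operatorname{asdim}X=\operatorname{asdim}Y$.
   Context: A continuous $t$-norm is a binary operation $*:[0,1]\times[0,1]\to[0,1]$ that is associative, commutative and continuous, satisfies $a*1=a$ for all $a\in[0,1]$, and satisfies $a*b\leq c*d$ whenever $a\leq c$ and $b\leq d$. A fuzzy metric space (in the sense of George and Veeramani) is a triple $(X,M,* )$ where $X$ is a set, $*$ is a continuous $t$-norm, and $M:X\times X\times(0,\infty)\to[0,1]$ satisfies for all $x,y,z\in X$ and all $s,t>0$: (1) $M(x,y,t)>0$; (2) $M(x,y,t)=1$ if and only if $x=y$; (3) $M(x,y,t)=M(y,x,t)$; (4) $M(x,y,t)*M(y,z,s)\leq M(x,z,t+s)$; (5) $M(x,y,\cdot)$ is continuous on $(0,\infty)$. A family $\mathcal{U}$ of subsets of $X$ is uniformly bounded if there exist $r\in(0,1)$ and $t>0$ such that $M(x,y,t)>1-r$ for all $x,y\in U$ and all $U\in\mathcal{U}$. Two subsets $U,U'$ are $(r,t)$-disjoint if $M(U,U',t)<1-r$, where $M(U,U',t)=\sup\{M(x,y,t)\mid x\in U,\,y\in U'\}$ (with $\sup\emptyset=0$); a family is $(r,t)$-disjoint if any two distinct elements of it are. For an integer $n\geq0$, $\operatorname{asdim}X\leq n$ means: for every $r\in(0,1)$ and $t>0$ there exist $(r,t)$-disjoint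 families $\mathcal{U}^0,\dots,\mathcal{U}^n$ of subsets of $X$ such that $\bigcup_i\mathcal{U}^i$ is a uniformly bounded cover of $X$. $\operatorname{asdim}X$ is the least such integer $n\geq0$, and $\infty$ if there is none. A map $f:X\to Y$ between fuzzy metric spaces $(X,M_1,*_1)$ and $(Y,M_2,*_2)$ is uniformly expansive if for all $A>0$ and $t>0$ there exist $B>0$ and $t'>0$ such that for all $x,y\in X$, $M_1(x,y,t)\geq A$ implies $M_2(f(x),f(y),t')\geq B$. It is effectively proper if for all $C>0$ and $t>0$ there exist $D>0$ and $t'>0$ such that for all $x,y\in X$, $M_2(f(x),f(y),t)\geq C$ implies $M_1(x,y,t')\geq D$. It is a coarse embedding if it is both uniformly expansive and effectively proper. It is coarsely onto if there exist $r\in(0,1)$ and $t>0$ such that for every $y\in Y$ there is $x\in X$ with $M_2(f(x),y,t)>1-r$. It is a coarse equivalence if it is a coarse embedding that is coarsely onto. *)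

(* Defs.v *)
From mathcomp Require Import all_boot all_order all_algebra.
From mathcomp Require Import all_classical all_reals all_analysis.
Import Order.TTheory GRing.Theory Num.Theory.
Import numFieldNormedType.Exports.

Set Implicit Arguments.
Unset Strict Implicit.
Unset Printing Implicit Defensive.

Local Open Scope classical_set_scope.
Local Open Scope ring_scope.

(* A t-norm is encoded as a total function on R x R; only its values on [0, 1] x [0, 1] are
   constrained or used. *)
Record continuous_tnorm (R : realType) (op : R -> R -> R) : Prop := {
  tnorm_range : forall a b, 0 <= a <= 1 -> 0 <= b <= 1 -> 0 <= op a b <= 1;
  tnormA : forall a b c, 0 <= a <= 1 -> 0 <= b <= 1 -> 0 <= c <= 1 ->
    op a (op b c) = op (op a b) c;
  tnormC : forall a b, 0 <= a <= 1 -> 0 <= b <= 1 -> op a b = op b a;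
  tnorm_continuous :
    {within `[0, 1] `*` `[0, 1], continuous (fun p : R * R => op p.1 p.2)};
  tnorm1 : forall a, 0 <= a <= 1 -> op a 1 = a;
  tnorm_mono : forall a b c d,
    0 <= a <= 1 -> 0 <= b <= 1 -> 0 <= c <= 1 -> 0 <= d <= 1 ->
    a <= c -> b <= d -> op a b <= op c d
}.

(* Fuzzy metric space in the sense of George and Veeramani; the values of
   M x y t for t <= 0 are irrelevant. *)
Record fuzzy_metric_space (R : realType) (X : Type) (M : X -> X -> R -> R)
    (op : R -> R -> R) : Prop := {
  fuzzy_tnorm : continuous_tnorm op;
  fuzzy_range : forall x y t, 0 < t -> 0 <= M x y t <= 1;
  fuzzy_gt0 : forall x y t, 0 < t -> 0 < M x y t;
  fuzzy_eq1 : forall x y t, 0 < t -> M x y t = 1 <-> x = y;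
  fuzzy_sym : forall x y t, 0 < t -> M x y t = M y x t;
  fuzzy_triangle : forall x y z s t, 0 < s -> 0 < t ->
    op (M x y t) (M y z s) <= M x z (t + s);
  fuzzy_continuous : forall x y,
    {within [set t | 0 < t], continuous (M x y)}
}.

Section AsymptoticDimension.
Variables (R : realType) (X : Type) (M : X -> X -> R -> R).

Definition uniformly_bounded (F : set (set X)) : Prop :=
  exists r t : R, [/\ 0 < r < 1, 0 < t &
    forall U, F U -> forall x y, U x -> U y -> M x y t > 1 - r].

(* The library's [sup] satisfies [sup set0 = 0], which is the convention
   needed when U or V is empty. *)
Definition set_fuzzy (U V : set X) (t : R) : R :=
  sup [set M x y t | x in U & y in V].

Definition disjoint_family (r t : R) (F : set (set X)) : Prop :=
  forall U V, F U -> F V -> U <> V -> set_fuzzy U V t < 1 - r.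

Definition asdim_le (n : nat) : Prop :=
  forall r t : R, 0 < r < 1 -> 0 < t ->
  exists F : 'I_n.+1 -> set (set X),
    [/\ forall i, disjoint_family r t (F i),
        \bigcup_(U in \bigcup_i F i) U = [set: X] &
        uniformly_bounded (\bigcup_i F i)].

Definition asdim : \bar nat :=
  match pselect (exists n, `[< asdim_le n >]) with
  | left h => EFin (ex_minn h)
  | right _ => +oo%E
  end.

End AsymptoticDimension.

Section CoarseMaps.
Variables (R : realType) (X Y : Type).
Variables (M1 : X -> X -> R -> R) (M2 : Y -> Y -> R -> R) (f : X -> Y).

Definition uniformly_expansive : Prop :=
  forall A t : R, 0 < A -> 0 < t ->
  exists B t' : R, [/\ 0 < B, 0 < t' &
    forall x y, M1 x y t >= A -> M2 (f x) (f y) t' >= B].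

Definition effectively_proper : Prop :=
  forall C t : R, 0 < C -> 0 < t ->
  exists D t' : R, [/\ 0 < D, 0 < t' &
    forall x y, M2 (f x) (f y) t >= C -> M1 x y t' >= D].

Definition coarse_embedding : Prop :=
  uniformly_expansive /\ effectively_proper.

Definition coarsely_onto : Prop :=
  exists r t : R, [/\ 0 < r < 1, 0 < t &
    forall y, exists x, M2 (f x) y t > 1 - r].

Definition coarse_equivalence : Prop := coarse_embedding /\ coarsely_onto.

End CoarseMaps.

(* Main.v *)
(** A coarse embedding pulls the covers of its target back to covers of its
    source: uniform expansiveness preserves disjointness of the families and
    effective properness preserves uniform boundedness.  So [asdim] is monotone
    along coarse embeddings.  A choice of [g y] with [f (g y)] near [y] is a
    coarse embedding in the other direction, since a product of three positive
    values of [M2] stays positive. *)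
Require Import Defs.
From mathcomp Require Import all_boot all_order all_algebra.
From mathcomp Require Import all_classical all_reals all_analysis.
From mathcomp Require Import lra.
Import Order.TTheory GRing.Theory Num.Theory.
Import numFieldNormedType.Exports.
Local Open Scope classical_set_scope.
Local Open Scope ring_scope.

Lemma tnorm_gt0 {R : realType} {op : R -> R -> R} :
  continuous_tnorm op ->
  (forall a b : R, 0 <= a <= 1 -> 0 <= b <= 1 ->
    a <> 0 -> b <> 0 -> op a b <> 0) ->
  forall {a b : R}, 0 < a <= 1 -> 0 < b <= 1 -> 0 < op a b <= 1.
Proof.
move=> top op_neq0 a b /andP[a0 a1] /andP[b0 b1].
have ha : 0 <= a <= 1 by rewrite ltW.
have hb : 0 <= b <= 1 by rewrite ltW.
have /andP[ab0 ->] := tnorm_range top ha hb; rewrite andbT lt_def ab0 andbT.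
by apply/eqP/op_neq0 => //; apply/eqP; rewrite gt_eqF.
Qed.

(** Two triangle inequalities and monotonicity of [op] give the bound [op (op c (Num.min A 1)) c],
    which is uniform in the points. Capping [A] at 1 keeps it in the domain of the t-norm. *)
Lemma fuzzy_chain3 {R : realType} {Y : Type} {M : Y -> Y -> R -> R}
    {op : R -> R -> R} :
  fuzzy_metric_space M op ->
  (forall a b : R, 0 <= a <= 1 -> 0 <= b <= 1 ->
    a <> 0 -> b <> 0 -> op a b <> 0) ->
  forall {c A s t : R}, 0 < c <= 1 -> 0 < A -> 0 < s -> 0 < t ->
  exists2 B : R, 0 < B & forall x u v y : Y,
    M x u s >= c -> M u v t >= A -> M v y s >= c -> M x y (s + t + s) >= B.
Proof.
move=> hM op_neq0 c A s t hc A0 s0 t0.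
have top := fuzzy_tnorm hM.
have op_gt0 := tnorm_gt0 top op_neq0.
have hm : 0 < Num.min A 1 <= 1 by rewrite lt_min A0 ltr01 ge_min lexx orbT.
have hcm := op_gt0 _ _ hc hm.
have W (a : R) : 0 < a <= 1 -> 0 <= a <= 1 by case/andP => /ltW -> ->.
have /andP[B0 _] := op_gt0 _ _ hcm hc.
exists (op (op c (Num.min A 1)) c) => // x u v y xu uv vy.
have st0 : 0 < s + t by rewrite addr_gt0.
have uv' : Num.min A 1 <= M u v t by rewrite ge_min uv.
have xv : op c (Num.min A 1) <= M x v (s + t).
  apply: le_trans (fuzzy_triangle hM x u v t0 s0).
  by apply: (tnorm_mono top) => //; [exact: W|exact: W|exact: (fuzzy_range hM)..].
apply: le_trans (fuzzy_triangle hM x v y s0 st0).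
by apply: (tnorm_mono top) => //; [exact: W|exact: W|exact: (fuzzy_range hM)..].
Qed.

Lemma asdim_le_coarse_embedding {R : realType} {X Y : Type}
    {M1 : X -> X -> R -> R} {M2 : Y -> Y -> R -> R} {f : X -> Y} {n : nat} :
  (forall x y t, 0 < t -> M2 x y t <= 1) ->
  coarse_embedding M1 M2 f -> asdim_le M2 n -> asdim_le M1 n.
Proof.
move=> M2_le1 [expf propf] dimY r t /andP[r0 r1] t0.
(* Bounding each value by half of [1 - r] leaves room for the supremum to stay strictly below
   [1 - r]. *)
have A0 : 0 < (1 - r) / 2 by rewrite divr_gt0 // subr_gt0.
have [B [t' [B0 t'0 fB]]] := expf _ _ A0 t0.
(* The cap at 1/2 makes [1 - Num.min B (1 / 2)] an admissible radius; disjointness at that radius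
   puts suprema below [B]. *)
have m0 : 0 < Num.min B (1 / 2) by rewrite lt_min B0 divr_gt0.
have m1 : Num.min B (1 / 2) < 1 by rewrite gt_min orbC; apply/orP; left; lra.
have hr' : 0 < 1 - Num.min B (1 / 2) < 1.
  by rewrite subr_gt0 m1 ltrBlDr ltrDl.
have [F [disF covF [s [u [/andP[s0 s1] u0 bndF]]]]] := dimY _ _ hr' t'0.
exists (fun i => [set f @^-1` U | U in F i]); split.
- move=> i _ _ [U FU <-] [V FV <-] UV.
  have neqUV : U <> V by move=> eqUV; apply: UV; rewrite eqUV.
  have := disF i U V FU FV neqUV; rewrite subKr /set_fuzzy => supUV.
  apply: (@le_lt_trans _ _ ((1 - r) / 2)); last by lra.
  (* An empty preimage gives supremum 0. *)
  set E := (X in sup X); have [->|E0] := eqVneq E set0.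
    by rewrite sup0 ltW.
  apply: ge_sup; first exact/set0P.
  (* A larger value would force [M2 (f x) (f y) t' >= B], against the supremum over [U] and [V]. *)
  move=> _ [x Ux [y Vy <-]]; rewrite leNgt; apply/negP => /ltW /fB.
  apply/negP; rewrite -ltNge; apply: (@le_lt_trans _ _ _ _ _ _ (lt_le_trans supUV _)).
    apply: ub_le_sup; last by exists (f x) => //; exists (f y).
    by exists 1 => _ [a _ [b _ <-]]; exact: M2_le1.
  by rewrite ge_min lexx.
- apply/seteqP; split=> // x _.
  have : [set: Y] (f x) by [].
  rewrite -covF => -[U [i _ FU] Ufx].
  by exists (f @^-1` U) => //; exists i => //; exists U.
- have C0 : 0 < 1 - s by rewrite subr_gt0.
  have [D [u' [D0 u'0 fD]]] := propf _ _ C0 u0.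
  have d0 : 0 < Num.min D 1 by rewrite lt_min D0 ltr01.
  have d1 : Num.min D 1 <= 1 by rewrite ge_min lexx orbT.
  have dD : Num.min D 1 <= D by rewrite ge_min lexx.
  (* Halving turns the weak bound [D] into the strict one required. *)
  exists (1 - Num.min D 1 / 2), u'; split=> //; first by lra.
  move=> _ [i _ [U FU <-]] x y Ux Uy.
  have /ltW/fD : 1 - s < M2 (f x) (f y) u by apply: (bndF U) => //; exists i.
  by apply: lt_le_trans; lra.
Qed.

(** The two properties swap roles: effective properness of [f] makes [g] uniformly expansive, and
    conversely. *)
Lemma coarse_inverse {R : realType} {X Y : Type}
    {M1 : X -> X -> R -> R} {M2 : Y -> Y -> R -> R} {op : R -> R -> R}
    {f : X -> Y} :
  fuzzy_metric_space M2 op ->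
  (forall a b : R, 0 <= a <= 1 -> 0 <= b <= 1 ->
    a <> 0 -> b <> 0 -> op a b <> 0) ->
  coarse_equivalence M1 M2 f -> exists g : Y -> X, coarse_embedding M2 M1 g.
Proof.
move=> hM op_neq0 [[expf propf] [r [s [/andP[r0 r1] s0 /choice[g fg]]]]].
have hc : 0 < 1 - r <= 1 by lra.
have fgl y : M2 (f (g y)) y s >= 1 - r by rewrite ltW.
have fgr y : M2 y (f (g y)) s >= 1 - r by rewrite (fuzzy_sym hM).
exists g; split=> A t A0 t0.
(* Chain: [f (g x)], [x], [y], [f (g y)]. *)
- have [B B0 HB] := fuzzy_chain3 hM op_neq0 hc A0 s0 t0.
  have st0 : 0 < s + t + s by rewrite !addr_gt0.
  have [D [t' [D0 t'0 fD]]] := propf _ _ B0 st0.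
  by exists D, t'; split=> // x y xy; apply/fD/(HB _ x y).
(* Chain: [x], [f (g x)], [f (g y)], [y]. *)
- have [B [t' [B0 t'0 fB]]] := expf _ _ A0 t0.
  have [D D0 HD] := fuzzy_chain3 hM op_neq0 hc B0 s0 t'0.
  exists D, (s + t' + s); split=> //; first by rewrite !addr_gt0.
  by move=> x y /fB xy; apply: (HD _ (f (g x)) (f (g y))).
Qed.

Lemma eq_asdim {R : realType} {X Y : Type}
    {M1 : X -> X -> R -> R} {M2 : Y -> Y -> R -> R} :
  (forall n, asdim_le M1 n <-> asdim_le M2 n) -> asdim M1 = asdim M2.
Proof.
move=> M12; rewrite /asdim.
(* [asdim] sees the space only through this predicate on [nat], so no minima need comparing. *)
by have -> : asdim_le M1 = asdim_le M2 by apply/funext => n; apply/propext.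
Qed.

Theorem theorem5p7 (R : realType) (X Y : Type)
    (M1 : X -> X -> R -> R) (op1 : R -> R -> R)
    (M2 : Y -> Y -> R -> R) (op2 : R -> R -> R)
    (hX : fuzzy_metric_space M1 op1) (hY : fuzzy_metric_space M2 op2)
    (hop1 : forall a b : R, 0 <= a <= 1 -> 0 <= b <= 1 ->
      a <> 0 -> b <> 0 -> op1 a b <> 0)
    (hop2 : forall a b : R, 0 <= a <= 1 -> 0 <= b <= 1 ->
      a <> 0 -> b <> 0 -> op2 a b <> 0)
    (f : X -> Y) (hf : coarse_equivalence M1 M2 f) :
  asdim M1 = asdim M2.
Proof.
have [g hg] := coarse_inverse hY hop2 hf.
have le1 (Z : Type) (M : Z -> Z -> R -> R) (op : R -> R -> R) :
    fuzzy_metric_space M op -> forall x y t, 0 < t -> M x y t <= 1.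
  by move=> hM x y t /(fuzzy_range hM x y)/andP[].
apply: eq_asdim => n; split.
- exact: asdim_le_coarse_embedding (le1 _ _ _ hX) hg.
- exact: asdim_le_coarse_embedding (le1 _ _ _ hY) hf.1.
Qed.
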